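(* Let $M^3(f_1,\ldots,f_6)$ be a 3-dimensional contact metric generalized $(\kappa,\mu)$-space form. Let $f,\overline f$ be functions on $M$, define $$f_1^{*}=f_1+f,\quad f_2^{*}=f_2-\frac f3,\quad f_3^{*}=f_3+f,\quad f_4^{*}=f_4+\overline f,\quad f_6^{*}=f_6+\overline f,$$ and let $f_5^{*}$ be an arbitrary function on $M$. Then $M^3$ is also a generalized $(\kappa,\mu)$-space form $M^3(f_1^{*},\ldots,f_6^{*})$, i.e. $R=\sum_{i=1}^6 f_i^{*}R_i$.
   Context: All functions and tensors are smooth. An almost contact metric manifold $(M,\phi,\xi,\eta,g)$ is an odd-dimensional Riemannian manifold $(M,g)$ with a $(1,1)$-tensor field $\phi$, a vector field $\xi$ and a 1-form $\eta$ with $\eta(\xi)=1$, $\phi^2X=-X+\eta(X)\xi$, $g(\phi X,\phi Y)=g(X,Y)-\eta(X)\eta(Y)$. It is a contact metric manifold if $d\eta(X,Y)=g(X,\phi Y)$, with the convention $2\,d\eta(X,Y)=X\eta(Y)-Y\eta(X)-\eta([X,Y])$. Put $h=\tfrac12 L_\xi\phi$ ($L$ the Lie derivative). The curvature is $R(X,Y)Z=\nabla_X\nabla_YZ-\nabla_Y\nabla_XZ-\nabla_{[X,Y]}Z$. An almost contact metric manifold is a generalized $(\kappa,\mu)$-space form, denoted $M(f_1,\ldots,f_6)$, if there are functions $f_1,\ldots,f_6$ on $M$ with $R=\sum_{i=1}^6 f_iR_i$, where $R_1(X,Y)Z=g(Y,Z)X-g(X,Z)Y$; $R_2(X,Y)Z=g(X,\phi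 Z)\phi Y-g(Y,\phi Z)\phi X+2g(X,\phi Y)\phi Z$; $R_3(X,Y)Z=\eta(X)\eta(Z)Y-\eta(Y)\eta(Z)X+g(X,Z)\eta(Y)\xi-g(Y,Z)\eta(X)\xi$; $R_4(X,Y)Z=g(Y,Z)hX-g(X,Z)hY+g(hY,Z)X-g(hX,Z)Y$; $R_5(X,Y)Z=g(hY,Z)hX-g(hX,Z)hY+g(\phi hX,Z)\phi hY-g(\phi hY,Z)\phi hX$; $R_6(X,Y)Z=\eta(X)\eta(Z)hY-\eta(Y)\eta(Z)hX+g(hX,Z)\eta(Y)\xi-g(hY,Z)\eta(X)\xi$. *)

(* Defs.v *)
From HB Require Import structures.
From mathcomp Require Import all_boot all_order all_algebra.
From mathcomp Require Import all_classical all_reals all_analysis.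

Set Implicit Arguments.
Unset Strict Implicit.
Unset Printing Implicit Defensive.
Import Order.TTheory GRing.Theory Num.Theory.
Import numFieldNormedType.Exports.

Local Open Scope classical_set_scope.
Local Open Scope ring_scope.

(* For a finite-dimensional V and an open U this is the usual class C^k on U:
   requiring differentiability and class C^k of every directional derivative
   is the same as requiring continuous partial derivatives up to order k+1. *)
Fixpoint class_C (R : realType) (V W : normedModType R) (k : nat)
    (U : set V) (f : V -> W) : Prop :=
  match k with
  | 0 => forall x, U x -> {for x, continuous f}
  | k'.+1 => (forall x, U x -> differentiable f x) /\
             (forall v : V, class_C k' U ('D_v f))
  end.

Definition smooth_on (R : realType) (V W : normedModType R)
    (U : set V) (f : V -> W) : Prop := forall k : nat, class_C k U f.

(* The maps cmap and cinv are total functions, but only their values on cdom,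
   respectively on the open set cmap @` cdom, are meaningful. *)
Record chart (R : realType) (n : nat) (M : topologicalType) := Chart {
  cdom : set M;
  cmap : M -> 'rV[R]_n;
  cinv : 'rV[R]_n -> M;
  cdom_open : open cdom;
  cimg_open : open (cmap @` cdom);
  cmapK : forall p, cdom p -> cinv (cmap p) = p;
  cmap_cont : forall p, cdom p -> {for p, continuous cmap};
  cinv_cont : forall y, (cmap @` cdom) y -> {for y, continuous cinv}
}.

Definition cimg (R : realType) (n : nat) (M : topologicalType)
  (c : chart R n M) : set 'rV[R]_n := cmap c @` cdom c.

(* Smooth manifolds without boundary of dimension n; chart_at selects one chart
   of the atlas around each point and serves only to coordinatize the tangent
   spaces. *)
Record manifold (R : realType) (n : nat) := Manifold {
  carrier :> topologicalType;
  manifold_hausdorff : hausdorff_space carrier;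
  manifold_second_countable : @second_countable carrier;
  atlas : set (chart R n carrier);
  chart_at : carrier -> chart R n carrier;
  chart_at_atlas : forall p, atlas (chart_at p);
  chart_at_dom : forall p, cdom (chart_at p) p;
  atlas_compat : forall c c', atlas c -> atlas c' ->
    smooth_on (cmap c @` (cdom c `&` cdom c')) (cmap c' \o cinv c)
}.

Section Calculus.
Context {R : realType} {n : nat} {M : manifold R n}.

(* A tangent vector at p is represented by its coordinates in the basis
   d/dx^1, .., d/dx^n given by the chart chart_at p. *)
Definition tangent (p : M) : Type := 'rV[R]_n.

(* Not assumed smooth: see smooth_vf. *)
Definition vfield : Type := M -> 'rV[R]_n.

(* The differential of the chart c at p, from T_p M to R^n, and its inverse,
   which sends e_i to the i-th coordinate vector of c at p. *)
Definition to_chart (c : chart R n M) (p : M) (v : 'rV[R]_n) : 'rV[R]_n :=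
  'd (cmap c \o cinv (chart_at p)) (cmap (chart_at p) p) v.

Definition of_chart (c : chart R n M) (p : M) (v : 'rV[R]_n) : 'rV[R]_n :=
  'd (cmap (chart_at p) \o cinv c) (cmap c p) v.

Definition in_chart (c : chart R n M) (X : vfield) : 'rV[R]_n -> 'rV[R]_n :=
  fun y => to_chart c (cinv c y) (X (cinv c y)).

Definition smooth_fun (f : M -> R) : Prop :=
  forall c, atlas c -> smooth_on (cimg c) (f \o cinv c).

Definition smooth_vf (X : vfield) : Prop :=
  forall c, atlas c -> smooth_on (cimg c) (in_chart c X).

(* Smoothness of tensor fields: their components in every chart of the atlas
   are smooth. *)
Definition smooth_form1 (eta : M -> {scalar 'rV[R]_n}) : Prop :=
  forall c (v : 'rV[R]_n), atlas c ->
    smooth_on (cimg c)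
      (fun y => let p := cinv c y in eta p (of_chart c p v) : R).

Definition smooth_endo (phi : M -> {linear 'rV[R]_n -> 'rV[R]_n}) : Prop :=
  forall c (v : 'rV[R]_n), atlas c ->
    smooth_on (cimg c)
      (fun y => let p := cinv c y in to_chart c p (phi p (of_chart c p v))).

Definition smooth_form2 (g : M -> 'rV[R]_n -> 'rV[R]_n -> R) : Prop :=
  forall c (v w : 'rV[R]_n), atlas c ->
    smooth_on (cimg c)
      (fun y => let p := cinv c y in g p (of_chart c p v) (of_chart c p w)).

Definition addv (X Y : vfield) : vfield := fun p => X p + Y p.

Definition scalev (f : M -> R) (X : vfield) : vfield := fun p => f p *: X p.

(* X f. *)
Definition vderiv (X : vfield) (f : M -> R) : M -> R := fun p =>
  'D_(X p) (f \o cinv (chart_at p)) (cmap (chart_at p) p).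

(* [X, Y]^i = X^j d_j Y^i - Y^j d_j X^i, computed at p in the chart chart_at p,
   i.e. the vector field with [X, Y] f = X (Y f) - Y (X f). *)
Definition lie_bracket (X Y : vfield) : vfield := fun p =>
  let c := chart_at p in
  'D_(X p) (in_chart c Y) (cmap c p) - 'D_(Y p) (in_chart c X) (cmap c p).

Definition endo_app (phi : M -> {linear 'rV[R]_n -> 'rV[R]_n}) (X : vfield) :
  vfield := fun p => phi p (X p).

Definition form_app (eta : M -> {scalar 'rV[R]_n}) (X : vfield) : M -> R :=
  fun p => eta p (X p).

(* (L_xi phi) X. *)
Definition lie_deriv (xi : vfield) (phi : M -> {linear 'rV[R]_n -> 'rV[R]_n})
    (X : vfield) : vfield := fun p =>
  lie_bracket xi (endo_app phi X) p - phi p (lie_bracket xi X p).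

(* With the normalization
   2 d eta (X, Y) = X (eta Y) - Y (eta X) - eta [X, Y]. *)
Definition ext_deriv (eta : M -> {scalar 'rV[R]_n}) (X Y : vfield) : M -> R :=
  fun p => 2^-1 * (vderiv X (form_app eta Y) p - vderiv Y (form_app eta X) p
                   - eta p (lie_bracket X Y p)).

End Calculus.

Arguments vfield {R n} M.
Arguments tangent {R n M} p.

Record riemannian_metric (R : realType) (n : nat) (M : manifold R n) :=
  RiemannianMetric {
  metric :> M -> 'rV[R]_n -> 'rV[R]_n -> R;
  metric_linear : forall p w, scalar (fun v => metric p v w);
  metric_sym : forall p v w, metric p v w = metric p w v;
  metric_pos : forall p v, v != 0 -> 0 < metric p v v;
  metric_smooth : smooth_form2 metric
}.

Definition inner (R : realType) (n : nat) (M : manifold R n)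
    (g : riemannian_metric M) (X Y : vfield M) : M -> R :=
  fun p => g p (X p) (Y p).

(* nabla is the Levi-Civita connection of g. It is a total function, constrained
   only on smooth vector fields. *)
Record levi_civita (R : realType) (n : nat) (M : manifold R n)
    (g : riemannian_metric M)
    (nabla : vfield M -> vfield M -> vfield M) : Prop := LeviCivita {
  nabla_smooth : forall X Y, smooth_vf X -> smooth_vf Y ->
    smooth_vf (nabla X Y);
  nabla_addl : forall X X' Y, smooth_vf X -> smooth_vf X' -> smooth_vf Y ->
    nabla (addv X X') Y = addv (nabla X Y) (nabla X' Y);
  nabla_scalel : forall f X Y, smooth_fun f -> smooth_vf X -> smooth_vf Y ->
    nabla (scalev f X) Y = scalev f (nabla X Y);
  nabla_addr : forall X Y Y', smooth_vf X -> smooth_vf Y -> smooth_vf Y' ->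
    nabla X (addv Y Y') = addv (nabla X Y) (nabla X Y');
  nabla_leibniz : forall f X Y, smooth_fun f -> smooth_vf X -> smooth_vf Y ->
    nabla X (scalev f Y) = addv (scalev (vderiv X f) Y) (scalev f (nabla X Y));
  nabla_torsion_free : forall X Y, smooth_vf X -> smooth_vf Y ->
    forall p, nabla X Y p - nabla Y X p = lie_bracket X Y p;
  nabla_metric : forall X Y Z, smooth_vf X -> smooth_vf Y -> smooth_vf Z ->
    forall p, vderiv X (inner g Y Z) p
              = inner g (nabla X Y) Z p + inner g Y (nabla X Z) p
}.

Definition curvature (R : realType) (n : nat) (M : manifold R n)
    (nabla : vfield M -> vfield M -> vfield M) (X Y Z : vfield M) : vfield M :=
  fun p => nabla X (nabla Y Z) p - nabla Y (nabla X Z) p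
           - nabla (lie_bracket X Y) Z p.

Record almost_contact_metric (R : realType) (n : nat) (M : manifold R n) :=
  AlmostContactMetric {
  acm_g : riemannian_metric M;
  acm_phi : M -> {linear 'rV[R]_n -> 'rV[R]_n};
  acm_xi : vfield M;
  acm_eta : M -> {scalar 'rV[R]_n};
  acm_odd : odd n;
  acm_phi_smooth : smooth_endo acm_phi;
  acm_xi_smooth : smooth_vf acm_xi;
  acm_eta_smooth : smooth_form1 acm_eta;
  acm_eta_xi : forall p, acm_eta p (acm_xi p) = 1;
  acm_phi2 : forall p (v : tangent p),
    acm_phi p (acm_phi p v) = - v + acm_eta p v *: acm_xi p;
  acm_compat : forall p (v w : tangent p),
    acm_g p (acm_phi p v) (acm_phi p w)
    = acm_g p v w - acm_eta p v * acm_eta p w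
}.

Section SpaceForms.
Context {R : realType} {n : nat} {M : manifold R n}.
Variable S : almost_contact_metric M.

Local Notation xi := (acm_xi S).
Local Notation g := (inner (acm_g S)).
Local Notation phi := (endo_app (acm_phi S)).
Local Notation eta := (form_app (acm_eta S)).

Definition contact_metric : Prop :=
  forall X Y : vfield M, smooth_vf X -> smooth_vf Y ->
    forall p, ext_deriv (acm_eta S) X Y p = g X (phi Y) p.

Definition acm_h (X : vfield M) : vfield M :=
  fun p => 2^-1 *: lie_deriv xi (acm_phi S) X p.

Local Notation h := acm_h.

Definition R1 (X Y Z : vfield M) : vfield M := fun p =>
  g Y Z p *: X p - g X Z p *: Y p.

Definition R2 (X Y Z : vfield M) : vfield M := fun p =>
  g X (phi Z) p *: phi Y p - g Y (phi Z) p *: phi X p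
  + (2 * g X (phi Y) p) *: phi Z p.

Definition R3 (X Y Z : vfield M) : vfield M := fun p =>
  (eta X p * eta Z p) *: Y p - (eta Y p * eta Z p) *: X p
  + (g X Z p * eta Y p) *: xi p - (g Y Z p * eta X p) *: xi p.

Definition R4 (X Y Z : vfield M) : vfield M := fun p =>
  g Y Z p *: h X p - g X Z p *: h Y p
  + g (h Y) Z p *: X p - g (h X) Z p *: Y p.

Definition R5 (X Y Z : vfield M) : vfield M := fun p =>
  g (h Y) Z p *: h X p - g (h X) Z p *: h Y p
  + g (phi (h X)) Z p *: phi (h Y) p - g (phi (h Y)) Z p *: phi (h X) p.

Definition R6 (X Y Z : vfield M) : vfield M := fun p =>
  (eta X p * eta Z p) *: h Y p - (eta Y p * eta Z p) *: h X p
  + (g (h X) Z p * eta Y p) *: xi p - (g (h Y) Z p * eta X p) *: xi p.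

(* The almost contact metric manifold (M, S) is M(f1, .., f6), where nabla is
   the Levi-Civita connection of its metric. *)
Definition gen_kappa_mu_space_form
    (nabla : vfield M -> vfield M -> vfield M)
    (f1 f2 f3 f4 f5 f6 : M -> R) : Prop :=
  [/\ smooth_fun f1, smooth_fun f2 & smooth_fun f3] /\
  [/\ smooth_fun f4, smooth_fun f5 & smooth_fun f6] /\
  forall X Y Z : vfield M, smooth_vf X -> smooth_vf Y -> smooth_vf Z ->
    forall p, curvature nabla X Y Z p =
      f1 p *: R1 X Y Z p + f2 p *: R2 X Y Z p + f3 p *: R3 X Y Z p
      + f4 p *: R4 X Y Z p + f5 p *: R5 X Y Z p + f6 p *: R6 X Y Z p.

End SpaceForms.

(* Main.v *)
Require Import Defs.
From HB Require Import structures.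
From mathcomp Require Import all_boot all_order all_algebra.
From mathcomp Require Import all_classical all_reals all_analysis.
From mathcomp Require Import ring lra.
Import Order.TTheory GRing.Theory Num.Theory.
Import numFieldNormedType.Exports.
Local Open Scope ring_scope.

(* In dimension 3 the tensors satisfy R2 = 3 (R1 + R3), R4 + R6 = 0 and R5 = 0
   pointwise. The first relation is linear algebra in an orthonormal frame
   (e, phi e, xi). The other two only need that h is tensorial, h xi = 0 and
   h phi + phi h = 0: these force the matrix of h on the contact plane to be
   symmetric and trace free. Differentiating phi^2 = -1 + eta (x) xi gives
   h phi + phi h = 1/2 (L_xi eta) (x) xi, and L_xi eta vanishes because
   (L_xi eta) X = 2 d eta (xi, X) = 2 g (xi, phi X) = 0.

   The contact condition only says that L_xi eta vanishes on the values of
   smooth vector fields. No extension of a tangent vector to a smooth vector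
   field is constructed: R4 + R6 and R5, applied to X, Y, only see the component
   of X /\ Y along e /\ phi e, and when it is nonzero, L_xi eta vanishes
   everywhere since it does on xi, X and Y. *)

Set Implicit Arguments.
Unset Strict Implicit.
Unset Printing Implicit Defensive.

(** * Differential calculus between normed spaces *)

Lemma near_eq_differentiable (R : realType) (V W : normedModType R)
    (f g : V -> W) (x : V) :
  (\near x, f x = g x) -> differentiable f x -> differentiable g x.
Proof.
move=> fg /diff_locallyP [cf ef].
(* The differential of [f] at [x] is a first-order expansion of [g] too, so by uniqueness it is the
   differential of [g]. *)
have eg : g \o shift x = cst (g x) + 'd f x +o_ 0 id.
  apply/eqaddoP => e e0; have /eqaddoP /(_ e e0) := ef.
  have fgx : f x = g x := nbhs_singleton fg.
  have : \forall h \near 0, f (h + x) = g (h + x).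
    by move: fg; rewrite (near_shift 0 x) subr0.
  move=> fg0; apply: filterS2 fg0 => h fgh.
  rewrite -fgx => Hf; suff : `|g (h + x) - (f x + 'd f x h)| <= e * `|h| by [].
  by rewrite -fgh; exact: Hf.
have dg := diff_unique cf eg.
by apply/diff_locallyP; rewrite dg.
Unshelve. all: by end_near. Qed.

(** Openness of [U] turns equality on [U] into equality near each of its points, and this passes to
    all directional derivatives. *)
Lemma class_C_eq (R : realType) (V W : normedModType R) (k : nat) (U : set V)
    (f g : V -> W) :
  open U -> (forall x, U x -> f x = g x) -> class_C k U f -> class_C k U g.
Proof.
move=> oU; elim: k f g => [|k IH] f g fg /=.
  move=> cf x Ux; rewrite /prop_for /continuous_at -fg//.
  apply: cvg_trans (cf x Ux); apply: near_eq_cvg.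
  near=> y; apply: fg; near: y; exact: open_nbhs_nbhs.
move=> [df cf]; split=> [x Ux|v].
  apply: near_eq_differentiable (df x Ux).
  near=> y; apply: fg; near: y; exact: open_nbhs_nbhs.
apply: IH (cf v) => x Ux; apply: near_eq_derive.
near=> y; apply: fg; near: y; exact: open_nbhs_nbhs.
Unshelve. all: by end_near. Qed.

Lemma class_C_add_scale (R : realType) (V W : normedModType R) (k : nat)
    (U : set V) (a : R) (f g : V -> W) :
  open U -> class_C k U f -> class_C k U g ->
  class_C k U (fun x => f x + a *: g x).
Proof.
move=> oU; elim: k f g => [|k IH] f g /=.
  by move=> cf cg x Ux; apply: cvgD (cf x Ux) (cvgZ (cvg_cst a) (cg x Ux)).
move=> [df cf] [dg cg]; split=> [x Ux|v].
  apply: (@differentiableD _ _ _ f (a *: g)); first exact: df.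
  by apply: differentiableZ; exact: dg.
apply: class_C_eq oU _ (IH _ _ (cf v) (cg v)) => x Ux.
have dfx : derivable f x v by exact/diff_derivable/df.
have dgx : derivable g x v by exact/diff_derivable/dg.
rewrite -deriveZ// -deriveD//; exact: derivableZ.
Qed.

(** Product rule, from the chain rule for the continuous bilinear map [*:%R] composed with the pair
    [(k, f)]. *)
Lemma derive_scale (R : realType) (V W : normedModType R) (k : V -> R)
    (f : V -> W) (x v : V) :
  differentiable k x -> differentiable f x ->
  differentiable (fun y => k y *: f y) x /\
  'D_v (fun y => k y *: f y) x = k x *: 'D_v f x + 'D_v k x *: f x.
Proof.
move=> dk df.
have bil : bilinear_for (GRing.Scale.Law.clone _ _ *:%R _)
    (GRing.Scale.Law.clone _ _ *:%R _) (@GRing.scale R W).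
  split=> [w|a] b c d /=; first by rewrite scalerDl scalerA.
  by rewrite scalerDr !scalerA mulrC.
pose B : {bilinear R -> W -> W} := HB.pack (@GRing.scale R W)
   (bilinear_isBilinear.Build R R W W _ _ (@GRing.scale R W) bil).
have Bc : continuous (fun q : R * W => B q.1 q.2).
  move=> q; exact: scale_continuous.
have dp := differentiable_pair dk df.
have dB := differentiable_bilin (k x, f x) Bc.
split; first exact: (differentiable_comp dp dB).
rewrite deriveE; last exact: (differentiable_comp dp dB).
rewrite [LHS](congr1 (@^~ v) (diff_comp dp dB)) /=.
by rewrite (diff_bilin (k x, f x) Bc) (diff_pair dk df) /= !deriveE.
Qed.

Lemma derive_lincomb (R : realType) (V W : normedModType R) (a : R)
    (f h : V -> W) (x v : V) : derivable f x v -> derivable h x v ->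
  'D_v (fun y => a *: f y + h y) x = a *: 'D_v f x + 'D_v h x.
Proof.
move=> df dh; have da : derivable (a *: f) x v by exact: derivableZ.
by have := deriveD da dh; rewrite deriveZ.
Qed.

Lemma derive_coord (R : realType) (V : normedModType R) (n : nat)
    (w : V -> 'rV[R]_n) (x v : V) (i : 'I_n) :
  differentiable w x ->
  differentiable (fun y => w y 0 i : R) x /\
  'D_v (fun y => w y 0 i : R) x = ('D_v w x : 'rV[R]_n) 0 i.
Proof.
move=> dw.
have coord_linear : linear (fun N : 'rV[R]_n => N 0 i : R).
  by move=> a u u'; rewrite !mxE.
pose L : {linear 'rV[R]_n -> R} := HB.pack (fun N : 'rV[R]_n => N 0 i : R)
  (GRing.isLinear.Build _ _ _ _ _ coord_linear).
have Lc : continuous L by exact: coord_continuous.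
have dL := linear_differentiable (w x) Lc.
have dLw := differentiable_comp dw dL.
split; first exact: dLw.
rewrite [LHS](deriveE _ dLw) [LHS](congr1 (@^~ v) (diff_comp dw dL)) /=.
by rewrite (diff_lin _ Lc) deriveE.
Qed.

(** Expanding [w] in the standard basis writes [A y (w y)] as a sum of scalar functions times the
    maps [A y (delta_mx 0 i)]; the product rule then applies termwise. *)
Lemma derive_linear_family (R : realType) (V W : normedModType R) (n : nat)
    (A : V -> 'rV[R]_n -> W) (w : V -> 'rV[R]_n) (x v : V) :
  (forall y, linear (A y)) ->
  (forall u, differentiable (fun y => A y u) x) -> differentiable w x ->
  differentiable (fun y => A y (w y)) x /\
  'D_v (fun y => A y (w y)) x = 'D_v (fun y => A y (w x)) x + A x ('D_v w x).
Proof.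
move=> linA dA dw.
have expA y u : A y u = \sum_i u 0 i *: A y (delta_mx 0 i).
  pose L : {linear 'rV[R]_n -> W} :=
    HB.pack (A y) (GRing.isLinear.Build _ _ _ _ _ (linA y)).
  rewrite -[A y]/(L : _ -> _) [in LHS](row_sum_delta u) linear_sum.
  by apply: eq_bigr => i _; rewrite linearZ.
have dcoord i : differentiable (fun y => w y 0 i : R) x.
  by have [] := derive_coord v i dw.
have Dcoord i : 'D_v (fun y => w y 0 i : R) x = ('D_v w x : 'rV[R]_n) 0 i.
  by have [] := derive_coord v i dw.
have expfun u : (fun y => A y (u y)) =
    \sum_i (fun y => u y 0 i *: A y (delta_mx 0 i)).
  by apply/funext => y; rewrite fct_sumE expA.
have dsc (u : V -> 'rV[R]_n) i (du : differentiable (fun y => u y 0 i : R) x) :=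
  derive_scale v du (dA (delta_mx 0 i)).
have dcst i : differentiable (fun y : V => w x 0 i : R) x.
  exact: differentiable_cst.
split.
  rewrite (expfun w); apply: differentiable_sum => i.
  by have [] := dsc w i (dcoord i).
rewrite (expfun w) (expfun (fun=> w x)) !derive_sum.
- rewrite (expA x ('D_v w x)) -big_split; apply: eq_bigr => i _ /=.
  have [_ ->] := dsc w i (dcoord i).
  have [_ ->] := dsc (fun=> w x) i (dcst i).
  by rewrite derive_cst scale0r addr0 Dcoord.
- by move=> i; apply: diff_derivable; have [] := dsc (fun=> w x) i (dcst i).
- by move=> i; apply: diff_derivable; have [] := dsc w i (dcoord i).
Qed.

(** * Charts and the coordinates of tangent vectors *)

Section Charts.
Context {R : realType} {n : nat} {M : manifold R n}.
Implicit Types (c : chart R n M) (p : M).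

Lemma smooth_on_differentiable (V W : normedModType R) (U : set V) (f : V -> W)
    (x : V) : smooth_on U f -> U x -> differentiable f x.
Proof. by move=> /(_ 1%N) [df _]; exact: df. Qed.

Lemma near_chart c p (P : M -> Prop) : cdom c p -> (\near p, P p) ->
  \forall y \near cmap c p, cimg c y /\ P (cinv c y).
Proof.
move=> cp Pp.
have cy : cimg c (cmap c p) by exists p.
have iy : {for cmap c p, continuous (cinv c)} := cinv_cont cy.
have ny : \forall y \near cmap c p, cimg c y.
  by apply: open_nbhs_nbhs; split => //; exact: cimg_open.
have Py : \forall y \near cmap c p, P (cinv c y).
  by apply: iy; rewrite (cmapK cp).
by near=> y; split; [exact: (near ny y)|exact: (near Py y)].
Unshelve. all: by end_near. Qed.

Lemma cinvK c (y : 'rV[R]_n) : cimg c y ->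
  cdom c (cinv c y) /\ cmap c (cinv c y) = y.
Proof. by move=> [q cq <-]; rewrite (cmapK cq). Qed.

(** Chain rule: the two transition maps compose to the identity near [cmap c' p]. *)
Lemma diff_transitionK c c' p (v : 'rV[R]_n) : atlas c -> atlas c' ->
  cdom c p -> cdom c' p ->
  'd (cmap c' \o cinv c) (cmap c p) ('d (cmap c \o cinv c') (cmap c' p) v) = v.
Proof.
move=> ac ac' cp c'p.
have dcc' : differentiable (cmap c' \o cinv c) (cmap c p).
  by apply: (smooth_on_differentiable (atlas_compat ac ac')); exists p.
have dc'c : differentiable (cmap c \o cinv c') (cmap c' p).
  by apply: (smooth_on_differentiable (atlas_compat ac' ac)); exists p.
have e : (cmap c \o cinv c') (cmap c' p) = cmap c p by rewrite /= cmapK.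
rewrite -e in dcc' *.
have dcomp := differentiable_comp dc'c dcc'.
rewrite -[LHS](congr1 (@^~ v) (diff_comp dc'c dcc')) -deriveE//.
rewrite -[RHS](derive_id (cmap c' p) v); apply: near_eq_derive.
have nc : \near p, cdom c p.
  by apply: open_nbhs_nbhs; split => //; exact: cdom_open.
apply: filterS (near_chart c'p nc) => y [/cinvK[_ yK] cy] /=.
by rewrite (cmapK cy).
Qed.

Lemma to_chartK c p (v : 'rV[R]_n) : atlas c -> cdom c p ->
  of_chart c p (to_chart c p v) = v.
Proof.
by move=> ac cp; apply: diff_transitionK => //;
  [exact: chart_at_atlas|exact: chart_at_dom].
Qed.

Lemma of_chartK c p (v : 'rV[R]_n) : atlas c -> cdom c p ->
  to_chart c p (of_chart c p v) = v.
Proof.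
by move=> ac cp; apply: diff_transitionK => //;
  [exact: chart_at_atlas|exact: chart_at_dom].
Qed.

Lemma to_chart_at p (v : 'rV[R]_n) : to_chart (chart_at p) p v = v.
Proof.
have := chart_at_dom p; set c := chart_at p => cp.
have ac : atlas c := chart_at_atlas p.
have dcc : differentiable (cmap c \o cinv c) (cmap c p).
  by apply: (smooth_on_differentiable (atlas_compat ac ac)); exists p.
rewrite /to_chart -/c -deriveE// -[RHS](derive_id (cmap c p) v).
apply: near_eq_derive.
by apply: filterS (near_chart cp (filterT : \near p, True)) => y [/cinvK[]].
Qed.

Lemma of_chart_at p (v : 'rV[R]_n) : of_chart (chart_at p) p v = v.
Proof. exact: to_chart_at. Qed.

Lemma to_chart_linear c p : linear (to_chart c p).
Proof.
by move=> a u v; exact: (linearP ('d (cmap c \o cinv (chart_at p)) _)).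
Qed.

Lemma of_chart_linear c p : linear (of_chart c p).
Proof.
by move=> a u v; exact: (linearP ('d (cmap (chart_at p) \o cinv c) _)).
Qed.

HB.instance Definition _ c p :=
  GRing.isLinear.Build _ _ _ _ (to_chart c p) (to_chart_linear c p).
HB.instance Definition _ c p :=
  GRing.isLinear.Build _ _ _ _ (of_chart c p) (of_chart_linear c p).

Lemma smooth_fun_add_scale (a : R) (f1 f2 : M -> R) :
  smooth_fun f1 -> smooth_fun f2 -> smooth_fun (fun p => f1 p + a * f2 p).
Proof.
move=> sf1 sf2 c ac k.
exact: (class_C_add_scale a (@cimg_open _ _ _ c) (sf1 c ac k) (sf2 c ac k)).
Qed.

End Charts.

(** * Almost contact identities and the tensors [h] and [L_xi eta] at a point *)

Section AlmostContact.
Context {R : realType} {n : nat} {M : manifold R n}.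
Variable S : almost_contact_metric M.
Local Notation xi := (acm_xi S).
Local Notation phi := (acm_phi S).
Local Notation eta := (acm_eta S).
Local Notation g := (acm_g S).

(** Since phi^2 xi = 0, the formula for phi^2 at phi xi gives phi xi = k xi with k = eta (phi xi);
    applying phi again gives k^2 xi = 0. *)
Lemma acm_phi_xi p : phi p (xi p) = 0.
Proof.
have xi0 : xi p != 0.
  apply/eqP => x0; have := acm_eta_xi S p.
  by rewrite x0 linear0 => /eqP; rewrite eq_sym oner_eq0.
have p2 : phi p (phi p (xi p)) = 0.
  by rewrite acm_phi2 acm_eta_xi scale1r addNr.
have := acm_phi2 S (p := p) (phi p (xi p)); rewrite p2 linear0.
move: (eta p _) => k /eqP; rewrite eq_sym addrC subr_eq0 eq_sym => /eqP pk.
move: p2; rewrite pk linearZ /= pk => /eqP.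
rewrite scalerA scaler_eq0 (negbTE xi0) orbF mulf_eq0 orbb => /eqP ->.
by rewrite scale0r.
Qed.

Lemma metric_xi p v : g p v (xi p) = eta p v.
Proof.
have := acm_compat S (p := p) v (xi p); rewrite acm_phi_xi acm_eta_xi.
rewrite mulr1 Defs.metric_sym.
(* Linearity with coefficient -1 at zero vectors yields g 0 w = 0. *)
have := metric_linear g p (phi p v) (-1) 0 0.
rewrite scaler0 addr0 mulN1r addNr => ->.
by move/esym/eqP; rewrite subr_eq0 => /eqP.
Qed.

(** Computing phi^3 v as phi (phi^2 v) and as phi^2 (phi v) leaves eta (phi v) xi = 0. *)
Lemma acm_eta_phi p v : eta p (phi p v) = 0.
Proof.
have := congr1 (phi p) (acm_phi2 S (p := p) v).
rewrite (acm_phi2 S (p := p) (phi p v)) linearD linearN linearZ /=.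
rewrite acm_phi_xi scaler0 => /addrI /(congr1 (eta p)).
by rewrite linearZ /= acm_eta_xi mulr1 linear0.
Qed.

Variable p : M.

Let c := chart_at p.
Let y0 := cmap c p.
Let ac : atlas c := chart_at_atlas p.
Let cp : cdom c p := chart_at_dom p.
Let y0K : cinv c y0 = p := cmapK cp.
Let cy0 : cimg c y0. Proof. by exists p. Qed.

(** Coordinate expressions of xi, phi and eta. Fixing [v] while [y] varies differentiates the
    components of the tensors alone; at [y0] the chart is the one that coordinatizes the tangent
    space, so [phic y0] is phi at [p]. *)
Let xic := in_chart c xi.
Let phic y v :=
  to_chart c (cinv c y) (phi (cinv c y) (of_chart c (cinv c y) v)).
Let etac y v : R := eta (cinv c y) (of_chart c (cinv c y) v).

Let phic_linear y : linear (phic y).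
Proof. by move=> a u v; rewrite /phic !linearP. Qed.

Let etac_linear y : linear (etac y : _ -> R).
Proof. by move=> a u v; rewrite /etac !linearP. Qed.

Let in_chart0 X : in_chart c X y0 = X p.
Proof. by rewrite /in_chart y0K to_chart_at. Qed.

Let phic0 v : phic y0 v = phi p v.
Proof. by rewrite /phic y0K to_chart_at of_chart_at. Qed.

Let etac0 v : etac y0 v = eta p v.
Proof. by rewrite /etac y0K of_chart_at. Qed.

Let in_chart_diff X : smooth_vf X -> differentiable (in_chart c X) y0.
Proof. by move=> sX; exact: smooth_on_differentiable (sX c ac) cy0. Qed.

Let xic_diff : differentiable xic y0.
Proof. exact: in_chart_diff (acm_xi_smooth S). Qed.

Let phic_diff v : differentiable (phic^~ v) y0.
Proof. exact: smooth_on_differentiable (acm_phi_smooth S v ac) cy0. Qed.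

Let etac_diff v : differentiable (etac^~ v : _ -> R) y0.
Proof. exact: smooth_on_differentiable (acm_eta_smooth S v ac) cy0. Qed.

Let xic_derive_linear a u v :
  'D_(a *: u + v) xic y0 = a *: 'D_u xic y0 + 'D_v xic y0.
Proof. by rewrite !(deriveE _ xic_diff) linearP. Qed.

Let near_cimg : \forall y \near y0, cimg c y.
Proof. by apply: open_nbhs_nbhs; split => //; exact: cimg_open. Qed.

Let phic_in_chart X y : cimg c y ->
  in_chart c (endo_app phi X) y = phic y (in_chart c X y).
Proof.
by move=> /cinvK[cq _]; rewrite /phic /in_chart /endo_app to_chartK.
Qed.

Let etac_in_chart X y : cimg c y ->
  form_app eta X (cinv c y) = etac y (in_chart c X y).
Proof.
by move=> /cinvK[cq _]; rewrite /etac /in_chart /form_app to_chartK.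
Qed.

Let phic2 y v : cimg c y ->
  phic y (phic y v) = - v + etac y v *: xic y.
Proof.
move=> /cinvK[cq _]; rewrite /phic to_chartK// acm_phi2.
by rewrite linearD linearN linearZ /= of_chartK.
Qed.

(* The value of h X at p as a function of X p: the derivatives of the components
   of X along xi cancel in L_xi phi. *)
Definition h_at (v : 'rV[R]_n) : 'rV[R]_n :=
  2^-1 *: ('D_(xi p) (phic^~ v) y0 - 'D_(phi p v) xic y0 + phi p ('D_v xic y0)).

(* (L_xi eta) v at p. *)
Definition lie_eta_at (v : 'rV[R]_n) : R :=
  'D_(xi p) (etac^~ v : _ -> R) y0 + eta p ('D_v xic y0).

Lemma h_at_linear : linear h_at.
Proof.
move=> a u v; rewrite /h_at.
have -> : phic^~ (a *: u + v) = (fun y => a *: phic y u + phic y v).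
  by apply/funext => y; rewrite phic_linear.
have du : derivable (phic^~ u) y0 (xi p) by exact/diff_derivable/phic_diff.
have dv : derivable (phic^~ v) y0 (xi p) by exact/diff_derivable/phic_diff.
rewrite (derive_lincomb a du dv) !(linearP (phi p), xic_derive_linear).
have comb (A B C D E F : 'rV[R]_n) (b : R) :
    b *: (a *: A + B - (a *: C + D) + (a *: E + F)) =
    a *: (b *: (A - C + E)) + b *: (B - D + F).
  by apply/rowP => j; rewrite !mxE; ring.
exact: comb.
Qed.

Lemma lie_eta_at_linear : scalar lie_eta_at.
Proof.
move=> a u v; rewrite /lie_eta_at.
have -> : (etac^~ (a *: u + v) : _ -> R) =
      (fun y => a *: (etac y u : R) + etac y v).
  by apply/funext => y; rewrite etac_linear.
have du : derivable (etac^~ u : _ -> R) y0 (xi p).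
  exact/diff_derivable/etac_diff.
have dv : derivable (etac^~ v : _ -> R) y0 (xi p).
  exact/diff_derivable/etac_diff.
rewrite (derive_lincomb a du dv) xic_derive_linear linearP.
by rewrite mulrDr addrACA.
Qed.

(** Tensoriality of h: the product rule for phi X produces phi (D_xi X), which phi [xi, X]
    cancels. *)
Lemma acm_hE X : smooth_vf X -> acm_h S X p = h_at (X p).
Proof.
move=> sX; rewrite /acm_h /h_at /lie_deriv; congr (_ *: _).
rewrite /lie_bracket -/c -/y0.
have -> : 'D_(xi p) (in_chart c (endo_app phi X)) y0 =
    'D_(xi p) (phic^~ (X p)) y0 + phi p ('D_(xi p) (in_chart c X) y0).
  rewrite -phic0 -[in RHS](in_chart0 X).
  have [_ <-] :=
    derive_linear_family (xi p) phic_linear phic_diff (in_chart_diff sX).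
  by apply: near_eq_derive; apply: filterS near_cimg => y; exact: phic_in_chart.
rewrite linearB /=.
have comb (A B C D : 'rV[R]_n) : A + B - C - (B - D) = A - C + D.
  by apply/rowP => j; rewrite !mxE; ring.
exact: comb.
Qed.

Lemma h_at_xi : h_at (xi p) = 0.
Proof.
rewrite -acm_hE; last exact: acm_xi_smooth.
rewrite /acm_h /lie_deriv /lie_bracket subrr linear0 subr0 -/c.
rewrite {2}/endo_app acm_phi_xi derive0 subr0.
have -> : in_chart c (endo_app phi xi) = cst 0.
  by apply/funext => y; rewrite /in_chart /endo_app acm_phi_xi linear0.
by rewrite derive_cst scaler0.
Qed.

(** With [v] constant in coordinates, phi^2 v is differentiated along xi by the product rule ([e1])
    and through phi^2 = -1 + eta (x) xi ([e2]). The term eta v D_xi xi of [e2] cancels against the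
    one in [e3]. *)
Lemma h_at_phi v :
  h_at (phi p v) + phi p (h_at v) = (2^-1 * lie_eta_at v) *: xi p.
Proof.
rewrite /h_at linearZ -scalerDr -scalerA; congr (_ *: _).
rewrite !linearD !linearN /= !acm_phi2.
have e1 : 'D_(xi p) (fun y => phic y (phic y v)) y0 =
    'D_(xi p) (phic^~ (phi p v)) y0 + phi p ('D_(xi p) (phic^~ v) y0).
  have [_ ->] :=
    derive_linear_family (xi p) phic_linear phic_diff (phic_diff v).
  by rewrite !phic0.
have e2 : 'D_(xi p) (fun y => phic y (phic y v)) y0 =
   eta p v *: 'D_(xi p) xic y0 + 'D_(xi p) (etac^~ v : _ -> R) y0 *: xi p.
  have [ds es] := derive_scale (xi p) (etac_diff v) xic_diff.
  have xi0 : xic y0 = xi p := in_chart0 xi.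
  (* The zero derivative of the constant [- v] is added so that the right side becomes the
     derivative of phi^2 v. *)
  rewrite etac0 xi0 in es; rewrite -es -[RHS]scale1r -[RHS]addr0.
  rewrite -(derive_cst (- v) y0 (xi p)).
  have dd := derivable_cst (- v) y0 (xi p).
  rewrite -(derive_lincomb 1 (diff_derivable ds) dd); apply: near_eq_derive.
  by apply: filterS near_cimg => y cy; rewrite scale1r addrC phic2.
rewrite /lie_eta_at.
have e3 : 'D_(- v + eta p v *: xi p) xic y0 =
    - 'D_v xic y0 + eta p v *: 'D_(xi p) xic y0.
  by rewrite !(deriveE _ xic_diff) linearD linearN linearZ.
have comb (A B D E F u : 'rV[R]_n) (k l m : R) :
    k *: B + l *: u = E + F ->
    E - (- A + k *: B) + D + (F - D + (- A + m *: u)) = (l + m) *: u.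
  move=> e; have -> : F = k *: B + l *: u - E by rewrite e addrC addKr.
  by apply/rowP => j; rewrite !mxE; ring.
rewrite e3; move: e1; rewrite e2; exact: comb.
Qed.

(** In d eta (xi, X) = 0 the term X (eta xi) vanishes because eta xi is constant, and the terms eta
    (D_xi X) from xi (eta X) and eta [xi, X] cancel. *)
Lemma lie_eta_at_contact X : contact_metric S -> smooth_vf X ->
  lie_eta_at (X p) = 0.
Proof.
move=> hc sX; have := hc xi X (acm_xi_smooth S) sX p.
rewrite /inner /endo_app Defs.metric_sym metric_xi acm_eta_phi /ext_deriv.
move=> /eqP; rewrite mulf_eq0 invr_eq0 pnatr_eq0 /= => /eqP.
rewrite /vderiv /lie_bracket -/c -/y0 -/xic.
have -> : 'D_(xi p) (form_app eta X \o cinv c) y0 =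
    'D_(xi p) (etac^~ (X p) : _ -> R) y0 + eta p ('D_(xi p) (in_chart c X) y0).
  rewrite -etac0 -[in RHS](in_chart0 X).
  have [_ <-] :=
    derive_linear_family (xi p) etac_linear etac_diff (in_chart_diff sX).
  by apply: near_eq_derive; apply: filterS near_cimg => y; exact: etac_in_chart.
have -> : form_app eta xi \o cinv c = cst 1.
  by apply/funext => y; exact: acm_eta_xi.
rewrite derive_cst subr0 linearB /= => <-.
by rewrite /lie_eta_at opprB addrACA subrr addr0.
Qed.

End AlmostContact.

(** * Linear algebra in an orthonormal frame (e, phi e, xi) *)

Section DimensionThree.
Context {R : realType} {M : manifold R 3}.
Variables (S : almost_contact_metric M) (p : M).
Local Notation xi := (acm_xi S p).
Local Notation phi := (acm_phi S p).
Local Notation eta := (acm_eta S p).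
Local Notation g := (acm_g S p).

Lemma metricl a u v w : g (a *: u + v) w = a * g u w + g v w.
Proof. exact: metric_linear. Qed.

Lemma metricr a u v w : g w (a *: u + v) = a * g w u + g w v.
Proof. by rewrite !(Defs.metric_sym _ _ w) metricl. Qed.

Lemma metric0l w : g 0 w = 0.
Proof.
have := metricl (-1) 0 0 w.
by rewrite scaler0 addr0 mulN1r addNr.
Qed.

Let etaP a u v : eta (a *: u + v) = a * eta u + eta v.
Proof. exact: linearP. Qed.

Lemma exists_horizontal_unit : exists e, eta e = 0 /\ g e e = 1.
Proof.
suff [v v0 ev] : exists2 v, v != 0 & eta v = 0.
  exists ((Num.sqrt (g v v))^-1 *: v).
  split; first by rewrite linearZ /= ev mulr0.
  have gv := metric_pos (acm_g S) p v0.
  rewrite -[_ *: v]addr0 metricl metricr metric0l.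
  rewrite (Defs.metric_sym _ _ v 0) metric0l !addr0 mulrA -invfM -expr2.
  rewrite sqr_sqrtr ?ltW// mulVf//; exact: lt0r_neq0.
have d0 i : delta_mx 0 i != 0 :> 'rV[R]_3.
  apply/eqP => /rowP/(_ i); rewrite !mxE !eqxx => /eqP; by rewrite oner_eq0.
pose e0 : 'rV[R]_3 := delta_mx 0 (inord 0).
pose e1 : 'rV[R]_3 := delta_mx 0 (inord 1).
have [e00|e00] := eqVneq (eta e0) 0; first by exists e0 => //; exact: d0.
(* This combination lies in the kernel of eta, and its coordinate along [e1] is [- eta e0], which is
   nonzero here. *)
exists (eta e1 *: e0 - eta e0 *: e1); last first.
  rewrite -scaleNr etaP -[_ *: e1]addr0 etaP linear0 addr0 mulNr.
  by rewrite [X in X - _]mulrC subrr.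
apply/eqP => /rowP/(_ (inord 1)); rewrite !mxE !eqxx /= => /eqP.
rewrite -val_eqE /= !inordK//= mulr0 sub0r mulr1 oppr_eq0; exact/negP.
Qed.

Variable e : 'rV[R]_3.
Hypotheses (eta_e : eta e = 0) (g_e : g e e = 1).

(** The nesting and the final [+ 0] let rules stated for [a *: u + v] peel off one frame vector at a
    time. *)
Let frame a b c : 'rV[R]_3 := a *: e + (b *: phi e + (c *: xi + 0)).

Let phi_phi_e : phi (phi e) = - e.
Proof. by rewrite acm_phi2 eta_e scale0r addr0. Qed.

Let eta_frame a b c : eta (frame a b c) = c.
Proof.
rewrite /frame !etaP linear0 eta_e acm_eta_phi acm_eta_xi.
by rewrite !mulr0 !add0r mulr1 addr0.
Qed.

Let phi_frame a b c : phi (frame a b c) = frame (- b) a 0.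
Proof.
rewrite /frame addr0 !linearD !linearZ /= phi_phi_e acm_phi_xi.
by apply/rowP => j; rewrite !mxE; ring.
Qed.

(** Compatibility at e and phi e, with phi^2 e = -e, makes this number its own opposite. *)
Let g_phi_e : g e (phi e) = 0.
Proof.
have := acm_compat S (p := p) e (phi e).
rewrite phi_phi_e eta_e mul0r subr0 -[- e]addr0 -scaleN1r metricr.
rewrite (Defs.metric_sym _ _ _ 0) metric0l (Defs.metric_sym _ _ _ e).
by lra.
Qed.

Let g_phi_phi : g (phi e) (phi e) = 1.
Proof. by rewrite acm_compat eta_e mul0r subr0. Qed.

Let g_frame a b c a' b' c' :
  g (frame a b c) (frame a' b' c') = a * a' + b * b' + c * c'.
Proof.
have xx : g xi xi = 1 by rewrite metric_xi acm_eta_xi.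
have ex : g e xi = 0 by rewrite metric_xi.
have fx : g (phi e) xi = 0 by rewrite metric_xi acm_eta_phi.
rewrite /frame !metricl metric0l !metricr.
rewrite !(Defs.metric_sym _ _ _ 0) !metric0l (Defs.metric_sym _ _ xi e).
rewrite (Defs.metric_sym _ _ xi (phi e)) (Defs.metric_sym _ _ (phi e) e).
by rewrite g_phi_phi g_phi_e g_e xx ex fx; ring.
Qed.

(** The matrix with rows e, phi e, xi is invertible: g (u B, u B) is the sum of the squares of the
    entries of u, so u B = 0 forces u = 0. *)
Let frameP v : exists a b c, v = frame a b c.
Proof.
pose B : 'M[R]_3 := \matrix_(i < 3) [:: e; phi e; xi]`_i.
have mulB u : u *m B = frame (u 0 0) (u 0 1) (u 0 (inord 2)).
  rewrite mulmx_sum_row !big_ord_recl big_ord0 /frame !rowK /=.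
  by congr (_ *: _ + (_ *: _ + (_ *: _ + _))); congr (u _ _); apply/val_inj;
    rewrite //= inordK.
have : row_free B.
  apply: inj_row_free => u; rewrite mulB => u0.
  have : g (u *m B) (u *m B) = 0 by rewrite mulB u0 metric0l.
  rewrite mulB g_frame => uu.
  have u2 : u 0 (inord 2) = 0 by nra.
  have u1 : u 0 1 = 0 by nra.
  have u0' : u 0 0 = 0 by nra.
  apply/rowP => j; rewrite mxE.
  case: j => [] [|[|[|//]]] /= j3;
    [rewrite -[RHS]u0'|rewrite -[RHS]u1|rewrite -[RHS]u2];
    by congr (u _ _); apply/val_inj; rewrite //= inordK.
rewrite row_free_unit => Bu; rewrite -(mulmxKV Bu v) mulB.
by do 3!eexists.
Qed.

Let frameZ k a b c : k *: frame a b c = frame (k * a) (k * b) (k * c).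
Proof. by apply/rowP => j; rewrite !mxE; ring. Qed.

Let frameD a b c a' b' c' :
  frame a b c + frame a' b' c' = frame (a + a') (b + b') (c + c').
Proof. by apply/rowP => j; rewrite !mxE; ring. Qed.

Let frameN a b c : - frame a b c = frame (- a) (- b) (- c).
Proof. by apply/rowP => j; rewrite !mxE; ring. Qed.

Let frame_xi : xi = frame 0 0 1.
Proof. by apply/rowP => j; rewrite !mxE; ring. Qed.

Let frame0 : 0 = frame 0 0 0.
Proof. by apply/rowP => j; rewrite !mxE; ring. Qed.

(** These stand for [h_at] and [lie_eta_at] at [p], so that only linear algebra remains. *)
Variables (h : 'rV[R]_3 -> 'rV[R]_3) (lam : 'rV[R]_3 -> R).
Hypotheses (h_linear : linear h) (lam_linear : scalar lam) (h_xi : h xi = 0)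
  (h_phi : forall v, h (phi v) + phi (h v) = (2^-1 * lam v) *: xi).

Let h0 : h 0 = 0.
Proof.
have := h_linear (-1) 0 0.
by rewrite scaler0 addr0 scaleN1r addNr.
Qed.

(** The contact-plane block is symmetric and trace free; the xi-components are kept as values of
    [lam], not yet known to vanish. *)
Let h_frame : exists a b, forall x1 x2 x3, h (frame x1 x2 x3) =
  frame (x1 * a + x2 * b) (x1 * b - x2 * a)
    (2^-1 * (x2 * lam e - x1 * lam (phi e))).
Proof.
have [a [b [c he]]] := frameP (h e); exists a, b.
have hf : h (phi e) = frame b (- a) (2^-1 * lam e).
  (* The relation [h_phi] at e determines h (phi e) from h e. *)
  apply: (addIr (phi (h e))); rewrite h_phi he phi_frame frame_xi frameZ frameD.
  by congr frame; ring.
have hN : h (- e) = - h e.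
  by rewrite -[- e]addr0 -scaleN1r h_linear h0 addr0 scaleN1r.
(* The xi-component of [h_phi] at phi e determines that of h e. *)
have := congr1 eta (h_phi (phi e)).
rewrite phi_phi_e hN he hf phi_frame frame_xi frameN frameZ frameD.
rewrite !eta_frame => cE.
have {}cE : c = - (2^-1 * lam (phi e)) by lra.
move=> x1 x2 x3; rewrite [in LHS]/frame !h_linear h0 h_xi he hf.
rewrite scaler0 !addr0 !frameZ frameD.
by congr frame; rewrite ?cE; ring.
Qed.

Lemma space_form_relations x y z : lam xi = 0 -> lam x = 0 -> lam y = 0 ->
  [/\ g x (phi z) *: phi y - g y (phi z) *: phi x + (2 * g x (phi y)) *: phi z =
      3 *: (g y z *: x - g x z *: y + (eta x * eta z *: y - eta y * eta z *: x +
        (g x z * eta y) *: xi - (g y z * eta x) *: xi)),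
      g y z *: h x - g x z *: h y + g (h y) z *: x - g (h x) z *: y +
      (eta x * eta z *: h y - eta y * eta z *: h x +
        (g (h x) z * eta y) *: xi - (g (h y) z * eta x) *: xi) = 0 &
      g (h y) z *: h x - g (h x) z *: h y + g (phi (h x)) z *: phi (h y) -
        g (phi (h y)) z *: phi (h x) = 0].
Proof.
have [a [b hE]] := h_frame.
have [x1 [x2 [x3 ->]]] := frameP x; have [y1 [y2 [y3 ->]]] := frameP y.
have [z1 [z2 [z3 ->]]] := frameP z.
have lam_frame u1 u2 u3 : lam xi = 0 ->
    lam (frame u1 u2 u3) = u1 * lam e + u2 * lam (phi e).
  move=> lxi; rewrite /frame !lam_linear lxi.
  have := lam_linear (-1) 0 0; rewrite scaler0 addr0 mulN1r addNr => ->.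
  by rewrite mulr0 !addr0.
move=> lxi; rewrite !lam_frame// => lx ly.
(* lam kills the horizontal parts of x and y: if these are independent, lam
   vanishes on the whole contact plane. *)
have dep : lam e = 0 /\ lam (phi e) = 0 \/
    (x1 = 0 /\ x2 = 0 \/ exists t, y1 = t * x1 /\ y2 = t * x2).
  (* Cramer's rule for the system [lam x = lam y = 0] in the unknowns [lam e] and [lam (phi e)]. *)
  have d1 : (x1 * y2 - x2 * y1) * lam e = 0.
    transitivity (y2 * (x1 * lam e + x2 * lam (phi e)) -
      x2 * (y1 * lam e + y2 * lam (phi e))); first by ring.
    by rewrite lx ly !mulr0 subrr.
  have d2 : (x1 * y2 - x2 * y1) * lam (phi e) = 0.
    transitivity (x1 * (y1 * lam e + y2 * lam (phi e)) -
      y1 * (x1 * lam e + x2 * lam (phi e))); first by ring.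
    by rewrite lx ly !mulr0 subrr.
  have [d0|dN] := eqVneq (x1 * y2 - x2 * y1) 0; last first.
    by left; split; apply: (mulfI dN); rewrite mulr0.
  right; have [x10|x1N] := eqVneq x1 0; last first.
    right; exists (y1 / x1); split; first by field.
    by apply: (mulfI x1N); rewrite mulrA [x1 * (_ / _)]mulrC divfK//; lra.
  have [x20|x2N] := eqVneq x2 0; first by left.
  right; exists (y2 / x2); split; last by field.
  by apply: (mulfI x2N); rewrite mulrA [x2 * (_ / _)]mulrC divfK//; lra.
rewrite frame_xi frame0 !hE !(phi_frame, eta_frame, g_frame).
rewrite !(frameZ, frameN, frameD).
split.
- by congr frame; ring.
(* If [lam] survives, x is a multiple of xi or y is a multiple of x plus a multiple of xi; the
   expression is antisymmetric in x, y and vanishes when either is xi. *)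
- by case: dep => [[-> ->]|[[-> ->]|[t [-> ->]]]]; congr frame; ring.
- by case: dep => [[-> ->]|[[-> ->]|[t [-> ->]]]]; congr frame; ring.
Qed.

End DimensionThree.

Unset Implicit Arguments.
Set Strict Implicit.
Set Printing Implicit Defensive.

Theorem theorem4p13 (R : realType) (M : manifold R 3)
    (S : almost_contact_metric M)
    (nabla : vfield M -> vfield M -> vfield M)
    (hnabla : levi_civita (acm_g S) nabla)
    (hcontact : contact_metric S)
    (f1 f2 f3 f4 f5 f6 : M -> R)
    (hform : gen_kappa_mu_space_form S nabla f1 f2 f3 f4 f5 f6)
    (f fbar f5' : M -> R)
    (hf : smooth_fun f) (hfbar : smooth_fun fbar) (hf5' : smooth_fun f5') :
  gen_kappa_mu_space_form S nabla
    (fun p => f1 p + f p)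
    (fun p => f2 p - f p / 3)
    (fun p => f3 p + f p)
    (fun p => f4 p + fbar p)
    f5'
    (fun p => f6 p + fbar p).
Proof.
have smoothD u v : smooth_fun u -> smooth_fun v ->
    smooth_fun (fun p => u p + v p).
  move=> su sv; have := smooth_fun_add_scale 1 su sv; congr smooth_fun.
  by apply/funext => q; rewrite mul1r.
have [[s1 s2 s3] [[s4 s5 s6] curvE]] := hform.
split; [|split].
- split; [exact: smoothD| |exact: smoothD].
  (* The function f2 - f/3 is read as f2 + (-1/3) f. *)
  have := smooth_fun_add_scale (- 3^-1) s2 hf; congr smooth_fun.
  by apply/funext => q; rewrite mulNr mulrC.
- by split => //; exact: smoothD.
move=> X Y Z sX sY sZ p; rewrite curvE//.
have [e [eta_e g_e]] := exists_horizontal_unit S p.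
have sxi := acm_xi_smooth S.
have [] := space_form_relations eta_e g_e (h_at_linear S p)
  (lie_eta_at_linear S p) (h_at_xi S p) (h_at_phi S p)
  (Z p) (lie_eta_at_contact p hcontact sxi) (lie_eta_at_contact p hcontact sX)
  (lie_eta_at_contact p hcontact sY).
rewrite -(acm_hE S p sX) -(acm_hE S p sY).
rewrite -/(R1 S X Y Z p) -/(R2 S X Y Z p) -/(R3 S X Y Z p).
rewrite -/(R4 S X Y Z p) -/(R5 S X Y Z p) -/(R6 S X Y Z p).
move: (R1 _ _ _ _ _) (R2 _ _ _ _ _) (R3 _ _ _ _ _) (R4 _ _ _ _ _)
  (R5 _ _ _ _ _) (R6 _ _ _ _ _) => r1 r2 r3 r4 r5 r6 -> /eqP.
rewrite addr_eq0 => /eqP -> ->.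
(* With r2 = 3 (r1 + r3), r4 = -r6 and r5 = 0 substituted, the added terms f r1 - (f/3) r2 + f r3
   and fbar (r4 + r6) cancel, and both coefficients of r5 disappear. *)
by apply/rowP => j; rewrite !mxE; field.
Qed.
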